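(* Assume that, for an extended class $\mathcal{K}_\infty$ function $\alpha$, the function $h(\mathbf{o}_i,\cdot)$ is a valid control barrier function (as defined in the context, with this $\alpha$) for the system $\frac{d}{dt}\mathbf{x}=A(\mathbf{x})\mathbf{x}+B(\mathbf{x})\mathbf{u}$, $\mathbf{x}\in\mathcal{X}$, $\mathbf{u}\in\mathcal{U}$, for any $\mathbf{o}_i\in\mathcal{O}$. Consider the switching update which, following a new observation $\mathbf{o}_i$ (with relative transform $\xi_i$) at time $t_i$, sets $$\mathbf{o}_\text{safe}\leftarrow\mathbf{o}_i\ \text{ and }\ \xi_\text{safe}\leftarrow\xi_i\quad\text{if } h(\mathbf{o}_i,\xi_i(\mathbf{x}(t_i)))\ge 0,$$ keeps the previous parameters $\mathbf{o}_\text{safe},\xi_\text{safe}$ otherwise, and uses $h(\mathbf{o},\mathbf{x})=h(\mathbf{o}_\text{safe},\xi_\text{safe}(\mathbf{x}))$. Then this switching update, applied at discrete time steps $t_i\in\{t_1,t_2,\dots,t_e\}$, $e\in\mathbb{N}$, with $t_i\le t_{i+1}$, together with any control law satisfying $$\nabla_\mathbf{x} h(\mathbf{o}_\text{safe},\xi_\text{safe}(\mathbf{x}))\cdot\frac{d}{dt}\mathbf{x}\ \ge\ -\alpha\big(h(\mathbf{o}_\text{safe},\xi_\text{safe}(\mathbf{x}))\big)\qquad\forall t\neq t_i,$$ with $\mathbf{o}_\text{safe},\xi_\text{safe}$ from the switching update, guarantees forward invariance of the switching safe set $$\mathcal{X}_\text{safe}=\{\mathbf{x}\in\mathcal{X}\mid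 h(\mathbf{o}_\text{safe},\xi_\text{safe}(\mathbf{x}))\ge 0\}.$$ That is, $\mathbf{x}(t_0)\in\mathcal{X}_\text{safe}$ implies $\mathbf{x}(t)\in\mathcal{X}_\text{safe}$ for all $t\ge t_0$.
   Context: System: $\frac{d}{dt}\mathbf{x}=f(\mathbf{x})+B(\mathbf{x})\mathbf{u}$ with $f(\mathbf{x})=A(\mathbf{x})\mathbf{x}$, state $\mathbf{x}\in\mathcal{X}\subseteq\mathbb{R}^n$, input $\mathbf{u}\in\mathcal{U}\subseteq\mathbb{R}^m$. The state space is divided into the compact, open subset $\mathcal{X}_\text{free}$ and the closed subset $\mathcal{X}_\text{obs}$ such that $\mathcal{X}=\mathcal{X}_\text{free}\cup\mathcal{X}_\text{obs}$, where $\mathcal{X}_\text{obs}$ is the set of states to be avoided. The origin is assumed safe, i.e. it lies in a safe set contained in $\mathcal{X}_\text{free}$ that is control invariant (from any initial state in the set there is an input trajectory in $\mathcal{U}$ keeping the state in the set for all later times). Observations: $\mathcal{O}\subset\mathbb{R}^o$ is the set of exteroceptive observations of an unknown environment, with $\mathbf{o}=\zeta(\mathbf{x})$ for an unknown function $\zeta$. The function $h(\mathbf{o},\mathbf{x})$ is real-valued and depends on the observation $\mathbf{o}\in\mathcal{O}$ and the state. Successive observations $\mathbf{o}_i$ are treated as discrete-time parameters of $h$, each describing a safe set in the local robot-centered frame in which it was obtained. The relative transform $\xi_i$ expresses a state $\mathbf{x}$ relative to the frame from which $\mathbf{o}_i$ originates; $\xi_\text{safe}$ is the transform belonging to $\mathbf{o}_\text{safe}$.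 The pair $(\mathbf{o}_\text{safe},\xi_\text{safe})$ denotes the current parameters at the given time, so the switching safe set changes when they are updated. $\nabla_\mathbf{x} h(\mathbf{o}_\text{safe},\xi_\text{safe}(\mathbf{x}))$ is the gradient with respect to $\mathbf{x}$ of $h(\mathbf{o}_\text{safe},\xi_\text{safe}(\mathbf{x}))$ for the current parameters. $t_0$ denotes the initial time. Extended class $\mathcal{K}_\infty$ function: a continuous, strictly increasing $\alpha:\mathbb{R}\to\mathbb{R}$ with $\alpha(0)=0$ and $\lim_{s\to\pm\infty}\alpha(s)=\pm\infty$. Control barrier function: let $g:\mathbb{R}^n\to\mathbb{R}$ be continuously differentiable with $0$-superlevel set $S=\{\mathbf{x}\in\mathcal{X}\mid g(\mathbf{x})\ge 0\}$ and $\{\mathbf{x}\in\mathcal{X}\mid\frac{dg}{d\mathbf{x}}(\mathbf{x})=0\}\cap\{\mathbf{x}\in\mathcal{X}\mid g(\mathbf{x})=0\}=\emptyset$. Then $g$ is a control barrier function for the system if there is an extended class $\mathcal{K}_\infty$ function $\alpha$ such that (a) $g(\mathbf{x})<0$ for all $\mathbf{x}\in\mathcal{X}_\text{obs}$, and (b) $\sup_{\mathbf{u}\in\mathcal{U}}[\mathcal{L}_f g(\mathbf{x})+\mathcal{L}_B g(\mathbf{x})\mathbf{u}]\ge-\alpha(g(\mathbf{x}))$ for all $\mathbf{x}\in S$, where $\mathcal{L}_f g$ and $\mathcal{L}_B g\,\mathbf{u}$ are the Lie derivatives of $g$ along $f$ and $B\mathbf{u}$. *)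

(* Defs.v *)
(* MathComp-Analysis *)
From HB Require Import structures.
From mathcomp Require Import all_boot all_order all_algebra.
From mathcomp Require Import all_classical all_reals all_analysis.

Set Implicit Arguments.
Unset Strict Implicit.
Unset Printing Implicit Defensive.

Import Order.TTheory GRing.Theory Num.Theory.
Import numFieldNormedType.Exports.

Local Open Scope classical_set_scope.
Local Open Scope ring_scope.

Definition ext_class_Kinfty (R : realType) (alpha : R -> R) : Prop :=
  [/\ continuous alpha, {homo alpha : a b / a < b}, alpha 0 = 0,
      alpha s @[s --> +oo] --> +oo & alpha s @[s --> -oo] --> -oo].

Definition dotv (R : realType) (n : nat) (v w : 'cV[R]_n) : R :=
  \sum_(i < n) v i 0 * w i 0.

Definition gradient (R : realType) (n : nat) (g : 'cV[R]_n -> R)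
    (z : 'cV[R]_n) : 'cV[R]_n :=
  \col_(i < n) 'D_(delta_mx i 0) g z.

Definition lie_derivative (R : realType) (n : nat) (g : 'cV[R]_n -> R)
    (F : 'cV[R]_n -> 'cV[R]_n) (z : 'cV[R]_n) : R :=
  dotv (gradient g z) (F z).

Definition continuously_differentiable (R : realType) (n : nat)
    (g : 'cV[R]_n -> R) : Prop :=
  (forall z, differentiable g z) /\ continuous (gradient g).

(* dx/dt = A(x) x + B(x) u with state x in [states], input u in [inputs]. *)
Record control_system (R : realType) (n m : nat) := ControlSystem {
  Amx : 'cV[R]_n -> 'M[R]_n;
  Bmx : 'cV[R]_n -> 'M[R]_(n, m);
  states : set 'cV[R]_n;
  inputs : set 'cV[R]_m;
  free_states : set 'cV[R]_n;
  obstacles : set 'cV[R]_n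
}.

Definition drift (R : realType) (n m : nat) (S : control_system R n m)
    (z : 'cV[R]_n) : 'cV[R]_n := Amx S z *m z.

(* "Open" and "closed" refer to the subspace topology of the state space, and
   "compact" is read as "with compact closure".  A subset of R^n (n >= 1) that
   is both compact and open in R^n is empty, which would contradict the safety
   of the origin; the present requirements follow from any stricter reading. *)
Definition state_space_division (R : realType) (n m : nat)
    (S : control_system R n m) : Prop :=
  [/\ states S = free_states S `|` obstacles S,
      free_states S `&` obstacles S = set0,
      precompact (free_states S),
      open (free_states S : set (subspace (states S))) &
      closed (obstacles S : set (subspace (states S)))].

(* The state is continuous on [t0, +oo[ and satisfies the differential equation
   at every t > t0 outside D, the set of instants where the input may jump. *)
Definition trajectory (R : realType) (n m : nat) (S : control_system R n m)
    (t0 : R) (D : set R) (x : R -> 'cV[R]_n) (u : R -> 'cV[R]_m) : Prop :=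
  [/\ {within `[t0, +oo[, continuous x},
      forall s, t0 <= s -> states S (x s),
      forall s, t0 <= s -> inputs S (u s) &
      forall s, t0 < s -> ~ D s ->
        is_derive s 1 x (drift S (x s) + Bmx S (x s) *m u s)].

Definition control_invariant (R : realType) (n m : nat)
    (S : control_system R n m) (C : set 'cV[R]_n) : Prop :=
  forall z, C z -> exists (D : set R) (x : R -> 'cV[R]_n) (u : R -> 'cV[R]_m),
    [/\ forall T, finite_set (D `&` `[0, T]), trajectory S 0 D x u,
        x 0 = z & forall s, 0 <= s -> C (x s)].

Definition origin_safe (R : realType) (n m : nat)
    (S : control_system R n m) : Prop :=
  exists C : set 'cV[R]_n, [/\ C `<=` free_states S, C 0 & control_invariant S C].

(* The supremum is taken in the extended reals, as it may be infinite. *)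
Definition control_barrier_function (R : realType) (n m : nat)
    (S : control_system R n m) (alpha : R -> R) (g : 'cV[R]_n -> R) : Prop :=
  [/\ ext_class_Kinfty alpha,
      continuously_differentiable g,
      [set z | states S z /\ gradient g z = 0]
        `&` [set z | states S z /\ g z = 0] = set0,
      forall z, obstacles S z -> g z < 0 &
      forall z, states S z -> 0 <= g z ->
        ((- alpha (g z))%:E <=
         ereal_sup [set (lie_derivative g (drift S) z
                         + lie_derivative g (fun y => Bmx S y *m u) z)%:E
                   | u in inputs S])%E].

(* The pair (o_safe, xi_safe) in force at time s: starting from the initial
   pair (o_ 0, xi_ 0), the switching updates i = 1, ..., e whose time t_ i has
   been reached are performed in order.  The value at an update time is the one
   after the update. *)
Definition safe_params (R : realType) (n p : nat)
    (h : 'cV[R]_p -> 'cV[R]_n -> R) (e : nat) (t_ : nat -> R)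
    (o_ : nat -> 'cV[R]_p) (xi_ : nat -> 'cV[R]_n -> 'cV[R]_n)
    (x : R -> 'cV[R]_n) (s : R) : 'cV[R]_p * ('cV[R]_n -> 'cV[R]_n) :=
  foldl (fun cur i =>
           if 0 <= h (o_ i) (xi_ i (x (t_ i))) then (o_ i, xi_ i) else cur)
        (o_ 0%N, xi_ 0%N) [seq i <- iota 1 e | t_ i <= s].

(* z |-> h(o_safe, xi_safe(z)) *)
Definition barrier (R : realType) (n p : nat)
    (h : 'cV[R]_p -> 'cV[R]_n -> R)
    (prm : 'cV[R]_p * ('cV[R]_n -> 'cV[R]_n)) (z : 'cV[R]_n) : R :=
  h prm.1 (prm.2 z).

Definition switching_safe_set (R : realType) (n m p : nat)
    (S : control_system R n m) (h : 'cV[R]_p -> 'cV[R]_n -> R)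
    (prm : 'cV[R]_p * ('cV[R]_n -> 'cV[R]_n)) : set 'cV[R]_n :=
  [set z | states S z /\ 0 <= barrier h prm z].

(* Main.v *)
(* Between two consecutive switching times the parameters are frozen; where the
   barrier is negative, the control law makes its derivative along the trajectory
   at least [- alpha] of a negative number, hence nonnegative, so the barrier
   cannot become negative.  At a switching time the state is continuous, and the
   parameters change only to ones whose barrier is nonnegative at that state.
   Since [t_] is sorted, the parameters in force at time [s] are those obtained
   after the first [k] updates for some [k], which allows induction on [k]. *)
Require Import Defs.
From HB Require Import structures.
From mathcomp Require Import all_boot all_order all_algebra.
From mathcomp Require Import all_classical all_reals all_analysis.

Set Implicit Arguments.
Unset Strict Implicit.
Unset Printing Implicit Defensive.

Import Order.TTheory GRing.Theory Num.Theory.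
Import numFieldNormedType.Exports.

Local Open Scope classical_set_scope.
Local Open Scope ring_scope.

(* A superlevel set of [phi] in a segment is compact; after its last point
   before [b] the function would be negative, hence nondecreasing. *)
Lemma ge0_barrier_segment (R : realType) (phi : R -> R) (a b : R) : a <= b ->
  {within `[a, b], continuous phi} ->
  (forall r, r \in `]a, b[ -> derivable phi r 1) ->
  (forall r, r \in `]a, b[ -> phi r <= 0 -> 0 <= 'D_1 phi r) ->
  0 <= phi a -> 0 <= phi b.
Proof.
move=> ab cphi dphi phi'ge0 phia.
pose E := `[a, b] `&` phi @^-1` [set y | 0 <= y].
have clE : closed E.
  rewrite /E closed_setSI; last exact: itv_closed.
  by apply: (proj1 (continuous_closedP _) cphi); exact: closed_ge.
have cE : compact E.
  by apply: (subclosed_compact clE (@segment_compact _ a b)) => r [].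
have E0 : E !=set0 by exists a; split => //=; rewrite in_itv/= lexx.
(* Maximising the identity over [E] yields its last point [c]. *)
have cid : {within E, continuous (fun r : R => r)}.
  by apply: continuous_subspaceT => r; exact: cvg_id.
have [c /[!inE] -[/= cab phic] cmax] := compact_EVT_max E0 cE cid.
move: cab; rewrite in_itv/= => /andP[ac cb].
have cb_ab r : r \in `]c, b[ -> r \in `]a, b[.
  by rewrite !in_itv/= => /andP[cr ->]; rewrite andbT; exact: le_lt_trans cr.
apply: (le_trans phic).
apply: (@ger0_derive1_ndecr _ phi c b) => // [r /cb_ab|r rcb|].
- exact: dphi.
- rewrite derive1E; apply: (phi'ge0 _ (cb_ab _ rcb)).
  have [//|phir] := leP (phi r) 0.
  have : r <= c.
    apply: cmax; rewrite inE; split; last exact: ltW.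
    exact: subset_itv_oo_cc (cb_ab _ rcb).
  by move: rcb; rewrite in_itv/= => /andP[/lt_geF ->].
- apply: continuous_subspaceW cphi => r /=; rewrite !in_itv/= => /andP[cr ->].
  by rewrite (le_trans ac cr).
Qed.

Lemma diff_gradient (R : realType) (n : nat) (g : 'cV[R]_n -> R)
    (z v : 'cV[R]_n) : differentiable g z -> 'd g z v = dotv (gradient g z) v.
Proof.
move=> dg; rewrite {1}[v]matrix_sum_delta linear_sum; apply: eq_bigr => i _.
by rewrite big_ord1 linearZ mxE deriveE// mulrC.
Qed.

(** Identifies the scalar product in the control law with the time derivative of the barrier along
    the trajectory. *)
Lemma is_derive_comp_gradient (R : realType) (n : nat) (g : 'cV[R]_n -> R)
    (x : R -> 'cV[R]_n) (r : R) :
  differentiable g (x r) -> derivable x r 1 ->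
  is_derive r 1 (g \o x) (dotv (gradient g (x r)) ('D_1 x r)).
Proof.
move=> dg /derivable1_diffP dx.
have dgx := differentiable_comp dx dg.
split; first exact: diff_derivable.
by rewrite deriveE// diff_comp//= -diff_gradient// [in RHS]deriveE.
Qed.

Section switching.
Context (R : realType) (n p : nat) (h : 'cV[R]_p -> 'cV[R]_n -> R).
Context (e : nat) (t_ : nat -> R) (o_ : nat -> 'cV[R]_p).
Context (xi_ : nat -> 'cV[R]_n -> 'cV[R]_n) (x : R -> 'cV[R]_n).
Hypothesis ht : forall i : nat, (i < e)%N -> t_ i <= t_ i.+1.

Definition update (cur : 'cV[R]_p * ('cV[R]_n -> 'cV[R]_n)) (i : nat) :=
  if 0 <= h (o_ i) (xi_ i (x (t_ i))) then (o_ i, xi_ i) else cur.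

(** Unlike [safe_params], indexed by the number of updates performed instead of by time, for
    induction over the updates. *)
Definition params_after (k : nat) := foldl update (o_ 0%N, xi_ 0%N) (iota 1 k).

Lemma params_afterS k : params_after k.+1 = update (params_after k) k.+1.
Proof. by rewrite /params_after -[in LHS](addn1 k) iotaD foldl_cat. Qed.

(** Whatever was accepted or rejected, the pair stems from a single observation, so the barrier
    function and differentiability hypotheses apply to it. *)
Lemma params_after_in k : exists2 i, (i <= k)%N & params_after k = (o_ i, xi_ i).
Proof.
elim: k => [|k [i ik prm]]; first by exists 0%N.
rewrite params_afterS /update; case: ifP => _; first by exists k.+1.
by exists i => //; exact: leqW.
Qed.

Lemma update_times_le i j : (i <= j <= e)%N -> t_ i <= t_ j.
Proof.
move=> /andP[ij]; rewrite -(subnKC ij); elim: (j - i)%N => [|d IHd].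
  by rewrite addn0.
by rewrite addnS => de; exact: le_trans (IHd (ltnW de)) (ht de).
Qed.

(** Sorted times make the updates reached by [s] a prefix of the list. The guards leave [s] without
    lower bound when [k] is 0 and without upper bound when [k] is [e]. *)
Lemma safe_params_after k s : (k <= e)%N -> ((0 < k)%N -> t_ k <= s) ->
  ((k < e)%N -> s < t_ k.+1) -> safe_params h e t_ o_ xi_ x s = params_after k.
Proof.
move=> ke tks stk; rewrite /safe_params -(subnKC ke) iotaD filter_cat.
rewrite (@eq_in_filter _ _ predT) ?filter_predT; last first.
  move=> i; rewrite mem_iota add1n ltnS => /andP[i0 ik] /=.
  by rewrite (le_trans _ (tks (leq_trans i0 ik)))// update_times_le ?ik.
rewrite (@eq_in_filter _ _ pred0) ?filter_pred0 ?cats0// => i.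
rewrite mem_iota add1n addSn subnKC// ltnS => /andP[ki ie] /=.
by apply/lt_geF/(lt_le_trans (stk (leq_trans ki ie)))/update_times_le/andP.
Qed.

(** The witness is the last index from 1 to [e] whose time is at most [s], or 0 if there is none. *)
Lemma reached_updates s : exists k, [/\ (k <= e)%N, (0 < k)%N -> t_ k <= s &
  (k < e)%N -> s < t_ k.+1].
Proof.
elim: (e) => [|d [k [kd tks stk]]]; first by exists 0%N.
have [ts|st] := leP (t_ d.+1) s; first by exists d.+1; rewrite ltnn.
move: kd; rewrite leq_eqVlt => /predU1P[kd|kd].
  by exists k; rewrite kd in tks *; split.
by exists k; split => // [|_]; [exact/leqW/ltnW|exact: stk].
Qed.

End switching.

Theorem theorem1 (R : realType) (n m p : nat) (S : control_system R n m)
    (hdiv : state_space_division S) (horig : origin_safe S)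
    (Obs : set 'cV[R]_p) (zeta : 'cV[R]_n -> 'cV[R]_p)
    (hObs : Obs `<=` zeta @` states S)
    (h : 'cV[R]_p -> 'cV[R]_n -> R) (alpha : R -> R)
    (halpha : ext_class_Kinfty alpha)
    (hcbf : forall o : 'cV[R]_p, Obs o -> control_barrier_function S alpha (h o))
    (e : nat) (t_ : nat -> R)
    (ht : forall i : nat, (i < e)%N -> t_ i <= t_ i.+1)
    (o_ : nat -> 'cV[R]_p) (ho : forall i : nat, (i <= e)%N -> Obs (o_ i))
    (xi_ : nat -> 'cV[R]_n -> 'cV[R]_n)
    (hxi : forall (i : nat) (z : 'cV[R]_n), (i <= e)%N ->
       differentiable (xi_ i) z)
    (x : R -> 'cV[R]_n) (u : R -> 'cV[R]_m)
    (htraj : trajectory S (t_ 0%N) [set t_ i | i in [set i | (1 <= i <= e)%N]] x u)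
    (hlaw : forall s : R, t_ 0%N < s ->
       (forall i : nat, (1 <= i <= e)%N -> s <> t_ i) ->
       - alpha (barrier h (safe_params h e t_ o_ xi_ x s) (x s)) <=
       dotv (gradient (barrier h (safe_params h e t_ o_ xi_ x s)) (x s))
            ('D_1 x s)) :
  switching_safe_set S h (safe_params h e t_ o_ xi_ x (t_ 0%N)) (x (t_ 0%N)) ->
  forall s : R, t_ 0%N <= s ->
    switching_safe_set S h (safe_params h e t_ o_ xi_ x s) (x s).
Proof.
have [xcont xS _ xder] := htraj.
pose P := params_after h t_ o_ xi_ x.
have t0_le i : (i <= e)%N -> t_ 0%N <= t_ i by move=> ie; apply: (update_times_le ht); rewrite ie.
have dP k z : (k <= e)%N -> differentiable (barrier h (P k)) z.
  move=> ke; rewrite /P.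
  have [i ik ->] := params_after_in h t_ o_ xi_ x k.
  have ie := leq_trans ik ke.
  have [_ [dh _] _ _ _] := hcbf _ (ho _ ie).
  exact: (differentiable_comp (hxi i z ie) (dh _)).
(* The bound [s <= t_ k.+1] is not strict: the old barrier is needed at the next update time itself,
   in case that update is rejected. *)
have flow k s : (k <= e)%N -> t_ k <= s -> ((k < e)%N -> s <= t_ k.+1) ->
    0 <= barrier h (P k) (x (t_ k)) -> 0 <= barrier h (P k) (x s).
  move=> ke tks stk.
  have between r : r \in `]t_ k, s[ -> t_ 0%N < r /\
      forall i, (1 <= i <= e)%N -> r <> t_ i.
    rewrite in_itv/= => /andP[tkr rs].
    split; first exact: le_lt_trans (t0_le _ ke) tkr.
    move=> i /andP[_ ie] rti; move: tkr rs; rewrite rti.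
    have [ik|ki] := leqP i k.
      by rewrite ltNge (update_times_le ht)// ik.
    move=> _ /lt_le_trans/(_ (stk (leq_trans ki ie))).
    by rewrite ltNge (update_times_le ht)// ki.
  have der r : r \in `]t_ k, s[ -> is_derive r 1 (barrier h (P k) \o x)
      (dotv (gradient (barrier h (P k)) (x r)) ('D_1 x r)).
    move=> /between[t0r rt]; apply: is_derive_comp_gradient; first exact: dP.
    have rD : ~ [set t_ i | i in [set i | (1 <= i <= e)%N]] r.
      by move=> [i ie] tir; exact: (rt i ie).
    by have [] := xder _ t0r rD.
  apply: (@ge0_barrier_segment _ (barrier h (P k) \o x)) => //.
  - apply: within_continuous_comp.
      by move=> z _; exact/differentiable_continuous/dP.
    apply: continuous_subspaceW xcont => r /=.
    by rewrite !in_itv/= andbT => /andP[+ _]; exact/le_trans/t0_le.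
  - by move=> r /der[].
  - move=> r rks /= phir; have [_ ->] := der r rks.
    have [t0r rt] := between r rks.
    have prm : safe_params h e t_ o_ xi_ x r = P k.
      move: rks; rewrite in_itv/= => /andP[/ltW tkr rs].
      apply: (safe_params_after h o_ xi_ x ht ke) => // /stk.
      exact: lt_le_trans.
    have := hlaw _ t0r rt; rewrite prm; apply: le_trans.
    have [_ alpha_incr alpha0 _ _] := halpha.
    rewrite oppr_ge0 -alpha0; move: phir; rewrite le_eqVlt => /predU1P[->//|].
    by move=> /alpha_incr/ltW.
(* Updates may coincide with the initial time. The safety assumption then concerns the parameters
   after [k0] of them, so the induction starts at [k0]. *)
move=> [_]; have [k0 [k0e tk0 t0k]] := reached_updates e t_ (t_ 0%N).
rewrite (safe_params_after h o_ xi_ x ht k0e tk0 t0k) -/(P k0) => safe0 s t0s.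
have tk0E : t_ k0 = t_ 0%N.
  apply/eqP; rewrite eq_le t0_le// andbT.
  by case: (k0) tk0 => // k; exact.
have safe_after k : (k0 <= k <= e)%N -> 0 <= barrier h (P k) (x (t_ k)).
  move=> /andP[k0k]; rewrite -(subnKC k0k).
  elim: (k - k0)%N => [|d IHd]; first by rewrite addn0 tk0E.
  rewrite addnS => de; rewrite /P params_afterS /update.
  (* An accepted update passes the very test required; after a rejected one, [flow] carries safety
     over from the previous time. *)
  case: ifPn => // _; apply: flow; [exact: ltnW|exact: ht|by []|].
  exact/IHd/ltnW.
have [k [ke tks stk]] := reached_updates e t_ s.
split; first exact: xS.
rewrite (safe_params_after h o_ xi_ x ht ke tks stk); apply: flow => //.
- by case: k tks {ke stk} => // k; exact.
- by move=> /stk/ltW.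
(* If [k < k0], then [s < t_ k.+1 <= t_ k0 = t_ 0%N], against [t_ 0%N <= s]. *)
apply: safe_after; rewrite ke andbT leqNgt; apply/negP => kk0.
have := stk (leq_trans kk0 k0e); rewrite ltNge => /negP; apply.
by rewrite (le_trans _ t0s)// -tk0E (update_times_le ht)// kk0.
Qed.
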